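(* Let $f$ be an invertible morphism of the $\dagger$-PROP $\mathbf{IF}(1,1)$. If $f$ belongs to the sub-PROP $\mathbf{HA}$, then $f$ is unitary, i.e. $f^{-1}=f^\dagger$.
   Context: $\mathbf{IF}(1,1)$ is the $\dagger$-PROP (strict symmetric monoidal $\dagger$-category with objects $\mathbb{N}$, tensor $=$ addition) generated by green morphisms $\mu_g:2\to1,\eta_g:0\to1$ and red morphisms $\mu_r:2\to1,\eta_r:0\to1$, with $\delta_c:=\mu_c^\dagger$, $\epsilon_c:=\eta_c^\dagger$ for $c\in\{g,r\}$, subject to: for each colour, $(\mu_c,\eta_c)$ is a commutative monoid, $(\mu_c\otimes\mathrm{id}_1)(\mathrm{id}_1\otimes\delta_c)=\delta_c\mu_c=(\mathrm{id}_1\otimes\mu_c)(\delta_c\otimes\mathrm{id}_1)$, and $\mu_c\delta_c=\mathrm{id}_1$; the bialgebra laws $\delta_g\mu_r=(\mu_r\otimes\mu_r)(\mathrm{id}_1\otimes\sigma\otimes\mathrm{id}_1)(\delta_g\otimes\delta_g)$, $\delta_g\eta_r=\eta_r\otimes\eta_r$, $\epsilon_g\mu_r=\epsilon_g\otimes\epsilon_g$ (scalar factors built from $\epsilon_g\eta_r$ suppressed by convention; $\epsilon_g\eta_r=\mathrm{id}_0$ not imposed); and $\eta_r=(\epsilon_r\otimes\mathrm{id}_1)\delta_g\eta_g$, $\epsilon_g=\epsilon_r\mu_r(\mathrm{id}_1\otimes\eta_g)$. The antipode is $s:=(\epsilon_g\mu_g\otimes\mathrm{id}_1)\circ(\mathrm{id}_1\otimes\delta_r\eta_r):1\to1$.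 $\mathbf{HA}$ is the sub-PROP of $\mathbf{IF}(1,1)$ generated (under composition, tensor and symmetries) by $\delta_g,\epsilon_g,\mu_r,\eta_r$ and $s$. *)

(* Defs.v *)
From mathcomp Require Import all_boot.

Set Implicit Arguments.
Unset Strict Implicit.
Unset Printing Implicit Defensive.

Declare Scope prop_scope.
Delimit Scope prop_scope with P.
Local Open Scope prop_scope.

Inductive colour := Green | Red.

(* Formal morphisms of the free dagger-PROP on the monoid generators.
   [compm f g] is f after g. *)
Inductive term : nat -> nat -> Type :=
| idm n : term n n
| swap m n : term (m + n) (n + m)
| compm m n p : term n p -> term m n -> term m p
| tens m n p q : term m n -> term p q -> term (m + p) (n + q)
| dag m n : term m n -> term n m
| mu (c : colour) : term 2 1
| eta (c : colour) : term 0 1.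

Notation "f ∘ g" := (compm f g) (at level 40, left associativity) : prop_scope.
Notation "f ⊗ g" := (tens f g) (at level 38, left associativity) : prop_scope.
Notation "f ^†" := (dag f) (at level 2, format "f ^†") : prop_scope.

Definition delta c : term 1 2 := (mu c)^†.
Definition epsilon c : term 1 0 := (eta c)^†.

Definition antipode : term 1 1 :=
  ((epsilon Green ∘ mu Green) ⊗ idm 1) ∘ (idm 1 ⊗ (delta Red ∘ eta Red)).

(* Transport along equalities of objects, needed to state strictness: the two
   bracketings of a sum of objects are equal but not convertible. *)
Definition cast m n m' n' (em : m = m') (en : n = n') (f : term m n) :
    term m' n' :=
  ecast k (term k n') em (ecast k (term m k) en f).

Reserved Notation "f ≈ g" (at level 70, no associativity).

(* Morphisms m -> n of IF(1,1) are the elements of [term m n] up to [≈], the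
   smallest dagger-monoidal congruence containing the laws of a strict symmetric
   monoidal dagger-category and the defining relations. Being closed under
   [dag], it also contains the dagger of every relation. The bialgebra laws
   carry no scalar factors, and epsilon Green ∘ eta Red ≈ idm 0 is not imposed. *)
Inductive eqIF : forall m n, term m n -> term m n -> Prop :=
| eqIF_refl m n (f : term m n) : f ≈ f
| eqIF_sym m n (f g : term m n) : f ≈ g -> g ≈ f
| eqIF_trans m n (f g h : term m n) : f ≈ g -> g ≈ h -> f ≈ h
| eqIF_comp m n p (f f' : term n p) (g g' : term m n) :
    f ≈ f' -> g ≈ g' -> f ∘ g ≈ f' ∘ g'
| eqIF_tens m n p q (f f' : term m n) (g g' : term p q) :
    f ≈ f' -> g ≈ g' -> f ⊗ g ≈ f' ⊗ g'
| eqIF_dag m n (f f' : term m n) : f ≈ f' -> f^† ≈ f'^†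

| comp_id_l m n (f : term m n) : idm n ∘ f ≈ f
| comp_id_r m n (f : term m n) : f ∘ idm m ≈ f
| comp_assoc m n p q (f : term p q) (g : term n p) (h : term m n) :
    f ∘ (g ∘ h) ≈ (f ∘ g) ∘ h

| tens_id m n : idm m ⊗ idm n ≈ idm (m + n)
| tens_comp m n p m' n' p'
    (f : term n p) (g : term m n) (f' : term n' p') (g' : term m' n') :
    (f ∘ g) ⊗ (f' ∘ g') ≈ (f ⊗ f') ∘ (g ⊗ g')
| tens_unit_l m n (f : term m n) : @eqIF m n (idm 0 ⊗ f) f
| tens_unit_r m n (f : term m n) : cast (addn0 m) (addn0 n) (f ⊗ idm 0) ≈ f
| tens_assoc m n m' n' m'' n''
    (f : term m n) (g : term m' n') (h : term m'' n'') :
    cast (addnA m m' m'') (addnA n n' n'') (f ⊗ (g ⊗ h)) ≈ (f ⊗ g) ⊗ h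

| swap_nat m n m' n' (f : term m m') (g : term n n') :
    swap m' n' ∘ (f ⊗ g) ≈ (g ⊗ f) ∘ swap m n
| swap_swap m n : swap n m ∘ swap m n ≈ idm (m + n)
| swap_unit n : cast (addn0 n) (erefl n) (swap n 0) ≈ idm n
| swap_hexagon m n p :
    swap m (n + p) ≈
    cast (esym (addnA m n p)) (addnA n p m)
      ((idm n ⊗ swap m p) ∘
       cast (erefl (m + n + p)) (esym (addnA n m p)) (swap m n ⊗ idm p))

| dag_dag m n (f : term m n) : f^†^† ≈ f
| dag_id n : (idm n)^† ≈ idm n
| dag_comp m n p (f : term n p) (g : term m n) : (f ∘ g)^† ≈ g^† ∘ f^†
| dag_tens m n p q (f : term m n) (g : term p q) : (f ⊗ g)^† ≈ f^† ⊗ g^†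
| dag_swap m n : (swap m n)^† ≈ swap n m

| mu_assoc c : mu c ∘ (mu c ⊗ idm 1) ≈ mu c ∘ (idm 1 ⊗ mu c)
| mu_comm c : mu c ∘ swap 1 1 ≈ mu c
| mu_unit_l c : mu c ∘ (eta c ⊗ idm 1) ≈ idm 1
| mu_unit_r c : mu c ∘ (idm 1 ⊗ eta c) ≈ idm 1
| frobenius_l c : (mu c ⊗ idm 1) ∘ (idm 1 ⊗ delta c) ≈ delta c ∘ mu c
| frobenius_r c : delta c ∘ mu c ≈ (idm 1 ⊗ mu c) ∘ (delta c ⊗ idm 1)
| special c : mu c ∘ delta c ≈ idm 1

| bialgebra :
    delta Green ∘ mu Red ≈
    (mu Red ⊗ mu Red) ∘ (idm 1 ⊗ swap 1 1 ⊗ idm 1) ∘ (delta Green ⊗ delta Green)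
| bialgebra_unit : delta Green ∘ eta Red ≈ eta Red ⊗ eta Red
| bialgebra_counit : epsilon Green ∘ mu Red ≈ epsilon Green ⊗ epsilon Green

| eta_Red_eq : eta Red ≈ (epsilon Red ⊗ idm 1) ∘ delta Green ∘ eta Green
| epsilon_Green_eq :
    epsilon Green ≈ epsilon Red ∘ mu Red ∘ (idm 1 ⊗ eta Green)
where "f ≈ g" := (eqIF f g) : prop_scope.

(* [HA f] says that the IF(1,1)-morphism represented by f lies in the sub-PROP;
   the last clause makes this a property of the class of f. The sub-PROP is not
   closed under the dagger. *)
Inductive HA : forall m n, term m n -> Prop :=
| HA_id n : HA (idm n)
| HA_swap m n : HA (swap m n)
| HA_comp m n p (f : term n p) (g : term m n) : HA f -> HA g -> HA (f ∘ g)
| HA_tens m n p q (f : term m n) (g : term p q) : HA f -> HA g -> HA (f ⊗ g)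
| HA_delta : HA (delta Green)
| HA_epsilon : HA (epsilon Green)
| HA_mu : HA (mu Red)
| HA_eta : HA (eta Red)
| HA_antipode : HA antipode
| HA_eq m n (f g : term m n) : f ≈ g -> HA f -> HA g.

Definition is_inverse m n (f : term m n) (g : term n m) : Prop :=
  g ∘ f ≈ idm m /\ f ∘ g ≈ idm n.

(* Main.v *)
(** Write [Δ] for the green comultiplication on [m] wires and [M] for its dagger.
    Every [f] in HA satisfies [Δ f = (f ⊗ f) Δ] and the reciprocity law
    [(f ⊗ 1) Δ f† = (1 ⊗ f†) Δ]. If moreover [f] is invertible and [h = f† f],
    cancelling [f] gives [Δ h = (1 ⊗ h) Δ] and [M (h ⊗ 1) Δ = 1]; since [M Δ = 1],
    cocommutativity yields [h = 1].

    Both laws are stable under composition and tensor, and both hold for a unitary as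
    soon as the first does, so the only difficult generators are the red multiplication
    and the antipode. Capping the bialgebra law by [εr] and [ηg] shows that the
    dagger of the antipode is a convolution inverse of the identity. The shear
    [(x, b) ↦ (x + b, b)] is therefore invertible, its inverse inherits the first law,
    and so does the antipode, which is then an involution. The Frobenius laws
    now identify the dagger of the shear with its inverse; thus the shear satisfies
    reciprocity, and so does [μr = (1 ⊗ εg) ∘ shear]. *)

From HB Require Import structures.
From mathcomp Require Import all_boot zify.
From mathcomp Require Import boolp.
Require Import Defs.
Set Implicit Arguments.
Unset Strict Implicit.
Unset Printing Implicit Defensive.
Local Open Scope prop_scope.

(** * The quotient of terms by [≈] *)

(** A class is the predicate [eqIF f] itself, so that extensionality turns equality in the PROP into
    Leibniz equality and equations can be used for rewriting. *)
Definition hom m n := {P : term m n -> Prop | exists f, P = eqIF f}.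

Definition class m n (f : term m n) : hom m n :=
  exist _ (eqIF f) (ex_intro _ f erefl).

Definition repr m n (h : hom m n) : term m n := sval (cid (svalP h)).

Lemma eq_class m n (f g : term m n) : (class f = class g) <-> f ≈ g.
Proof.
split=> [[fg]|fg]; first by rewrite fg; apply: eqIF_refl.
apply: eq_exist; apply/funext => h; apply/propext; split.
  by apply: eqIF_trans; apply: eqIF_sym.
exact: eqIF_trans.
Qed.

Lemma reprK m n (h : hom m n) : class (repr h) = h.
Proof. by case: h => P eP; apply: eq_exist; rewrite /repr; case: cid. Qed.

Lemma classK m n (f : term m n) : repr (class f) ≈ f.
Proof. by apply/eq_class; rewrite reprK. Qed.

(** Together with its dagger this inhabits every hom-set, which supplies the junk value in
    [comp]. *)
Fixpoint etas n : term 0 n :=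
  if n is n'.+1 then eta Green ⊗ etas n' else idm 0.

(* Leibniz equality of [mor] ignores the bracketing of objects, so that the strict
   monoidal laws can be stated without casts. *)
Record mor := Mor {dom : nat; cod : nat; hom_of : hom dom cod}.

Definition mk m n (f : term m n) : mor := Mor (class f).

(* When the types do not match, the composite is a junk morphism of the expected
   type, so that [dom_comp] and [cod_comp] need no hypothesis. *)
HB.lock Definition comp (f g : mor) : mor :=
  @Mor (dom g) (cod f)
    match @eqP _ (cod g) (dom f) with
    | ReflectT e => class (ecast k (term k (cod f)) (esym e) (repr (hom_of f))
                             ∘ repr (hom_of g))
    | ReflectF _ => class (etas (cod f) ∘ (etas (dom g))^†)
    end.

HB.lock Definition tensor (f g : mor) : mor :=
  mk (repr (hom_of f) ⊗ repr (hom_of g)).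

HB.lock Definition dagger (f : mor) : mor := mk (repr (hom_of f))^†.

Lemma mk_ind (P : mor -> Prop) :
  (forall m n (f : term m n), P (mk f)) -> forall f, P f.
Proof. by move=> Pmk [m n f]; rewrite -(reprK f); apply: Pmk. Qed.

Lemma mk_eq m n (f g : term m n) : f ≈ g -> mk f = mk g.
Proof. by rewrite /mk => /eq_class ->. Qed.

Lemma mk_inj m n (f g : term m n) : mk f = mk g -> f ≈ g.
Proof.
move=> fg; apply/eq_class.
(* [h] reads a morphism back at type [m -> n], with [class f] as default on a type mismatch. On
   [mk x] its transports are trivial, equality proofs on [nat] being unique. *)
pose h (x : mor) := if (@eqP _ (dom x) m, @eqP _ (cod x) n) is
  (ReflectT e, ReflectT e') then
    ecast k (hom k n) e (ecast k (hom (dom x) k) e' (hom_of x)) else class f.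
have hE x : h (mk x) = class x.
  rewrite /h /=; case: eqP => // e; case: eqP => // e'.
  by rewrite !eq_axiomK.
by rewrite -hE fg hE.
Qed.

Lemma mk_cast m n m' n' (em : m = m') (en : n = n') (f : term m n) :
  mk (cast em en f) = mk f.
Proof. by case: m' / em; case: n' / en. Qed.

Lemma mk_comp m n p (f : term n p) (g : term m n) : comp (mk f) (mk g) = mk (f ∘ g).
Proof.
rewrite comp.unlock /=; case: eqP => // e; rewrite eq_axiomK /=.
by apply: mk_eq; apply: eqIF_comp; apply: classK.
Qed.

Lemma mk_tens m n p q (f : term m n) (g : term p q) :
  tensor (mk f) (mk g) = mk (f ⊗ g).
Proof. by rewrite tensor.unlock; apply: mk_eq; apply: eqIF_tens; apply: classK. Qed.

Lemma mk_dag m n (f : term m n) : dagger (mk f) = mk f^†.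
Proof. by rewrite dagger.unlock; apply: mk_eq; apply: eqIF_dag; apply: classK. Qed.

Definition mkE := (mk_comp, mk_tens, mk_dag).

Declare Scope mor_scope.
Delimit Scope mor_scope with M.
Bind Scope mor_scope with mor.
Notation "f ∘ g" := (comp f g) : mor_scope.
Notation "f ⊗ g" := (tensor f g) : mor_scope.
Notation "f ^†" := (dagger f) : mor_scope.
Local Notation idn n := (mk (idm n)).
Local Notation σ m n := (mk (swap m n)).

Local Open Scope mor_scope.

(** * Calculus of strict symmetric monoidal dagger-categories *)

Lemma dom_comp f g : dom (f ∘ g) = dom g. Proof. by rewrite comp.unlock. Qed.
Lemma cod_comp f g : cod (f ∘ g) = cod f. Proof. by rewrite comp.unlock. Qed.
Lemma dom_tensor f g : dom (f ⊗ g) = dom f + dom g. Proof. by rewrite tensor.unlock. Qed.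
Lemma cod_tensor f g : cod (f ⊗ g) = cod f + cod g. Proof. by rewrite tensor.unlock. Qed.
Lemma dom_dagger f : dom f^† = cod f. Proof. by rewrite dagger.unlock. Qed.
Lemma cod_dagger f : cod f^† = dom f. Proof. by rewrite dagger.unlock. Qed.
Lemma dom_mk m n (f : term m n) : dom (mk f) = m. Proof. by []. Qed.
Lemma cod_mk m n (f : term m n) : cod (mk f) = n. Proof. by []. Qed.

Definition typeE := (dom_comp, cod_comp, dom_tensor, cod_tensor, dom_dagger,
  cod_dagger, dom_mk, cod_mk).
(** Through the hint below, [//] closes the side conditions on domains and codomains. The tactic is
    redefined as new morphisms appear. *)
Ltac typecheck := rewrite ?typeE; lia.
#[local] Hint Extern 0 (@eq nat _ _) => solve [typecheck] : core.

Ltac mor_elim f := elim/mk_ind: f => ? ? f.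

Lemma compf1 f n : dom f = n -> f ∘ idn n = f.
Proof. by mor_elim f => /= <-; rewrite mkE; apply/mk_eq/comp_id_r. Qed.

Lemma comp1f f n : cod f = n -> idn n ∘ f = f.
Proof. by mor_elim f => /= <-; rewrite mkE; apply/mk_eq/comp_id_l. Qed.

Lemma compA f g h : cod h = dom g -> cod g = dom f -> f ∘ (g ∘ h) = f ∘ g ∘ h.
Proof.
elim/mk_ind: f => n p f; elim/mk_ind: g => k n' g; elim/mk_ind: h => m k' h /=.
by move=> e e'; subst; rewrite !mkE; apply/mk_eq/comp_assoc.
Qed.

Lemma tens1 m n : idn m ⊗ idn n = idn (m + n).
Proof. by rewrite mkE; apply/mk_eq/tens_id. Qed.

Lemma tens_compE f g f' g' : cod g = dom f -> cod g' = dom f' ->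
  (f ∘ g) ⊗ (f' ∘ g') = (f ⊗ f') ∘ (g ⊗ g').
Proof.
elim/mk_ind: f => n p f; elim/mk_ind: g => m n1 g.
elim/mk_ind: f' => n' p' f'; elim/mk_ind: g' => m' n1' g' /= e e'.
by subst; rewrite !mkE; apply/mk_eq/tens_comp.
Qed.

Lemma tens0f f : idn 0 ⊗ f = f.
Proof. by mor_elim f; rewrite mkE; apply/mk_eq/tens_unit_l. Qed.

Lemma tensf0 f : f ⊗ idn 0 = f.
Proof.
by mor_elim f; rewrite mkE -(mk_cast (addn0 _) (addn0 _)); apply/mk_eq/tens_unit_r.
Qed.

Lemma tensA f g h : f ⊗ (g ⊗ h) = f ⊗ g ⊗ h.
Proof.
mor_elim f; mor_elim g; mor_elim h; rewrite !mkE.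
by rewrite -(mk_cast (addnA _ _ _) (addnA _ _ _)); apply/mk_eq/tens_assoc.
Qed.

Lemma swap_natural f g : σ (cod f) (cod g) ∘ (f ⊗ g) = (g ⊗ f) ∘ σ (dom f) (dom g).
Proof. by mor_elim f; mor_elim g; rewrite /= !mkE; apply/mk_eq/swap_nat. Qed.

Lemma swapK m n : σ n m ∘ σ m n = idn (m + n).
Proof. by rewrite mkE; apply/mk_eq/swap_swap. Qed.

Lemma swap0r n : σ n 0 = idn n.
Proof. by rewrite -(mk_cast (addn0 n) (erefl n)); apply/mk_eq/swap_unit. Qed.

Lemma swapDr m n p : σ m (n + p) = (idn n ⊗ σ m p) ∘ (σ m n ⊗ idn p).
Proof.
rewrite (mk_eq (swap_hexagon m n p)) mk_cast -mk_comp mk_cast.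
by rewrite -!mk_tens.
Qed.

Lemma daggerK f : f^†^† = f.
Proof. by mor_elim f; rewrite !mkE; apply/mk_eq/dag_dag. Qed.

Lemma dagger1 n : (idn n)^† = idn n.
Proof. by rewrite mkE; apply/mk_eq/dag_id. Qed.

Lemma dagger_comp f g : cod g = dom f -> (f ∘ g)^† = g^† ∘ f^†.
Proof.
elim/mk_ind: f => n p f; elim/mk_ind: g => m n1 g /= e.
by subst; rewrite !mkE; apply/mk_eq/dag_comp.
Qed.

Lemma dagger_tens f g : (f ⊗ g)^† = f^† ⊗ g^†.
Proof. by mor_elim f; mor_elim g; rewrite !mkE; apply/mk_eq/dag_tens. Qed.

Lemma dagger_swap m n : (σ m n)^† = σ n m.
Proof. by rewrite mkE; apply/mk_eq/dag_swap. Qed.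

Lemma tens1_comp n f g : cod g = dom f -> idn n ⊗ (f ∘ g) = (idn n ⊗ f) ∘ (idn n ⊗ g).
Proof. by move=> gf; rewrite -tens_compE ?compf1. Qed.

Lemma comp_tens1 n f g : cod g = dom f -> (f ∘ g) ⊗ idn n = (f ⊗ idn n) ∘ (g ⊗ idn n).
Proof. by move=> gf; rewrite -tens_compE ?compf1. Qed.

Lemma tensEl f g m p : dom f = m -> cod g = p -> f ⊗ g = (f ⊗ idn p) ∘ (idn m ⊗ g).
Proof. by move=> gp fm; rewrite -tens_compE ?compf1 ?comp1f. Qed.
Arguments tensEl : clear implicits.

Lemma tensEr f g n p : cod f = n -> dom g = p -> f ⊗ g = (idn n ⊗ g) ∘ (f ⊗ idn p).
Proof. by move=> gp fm; rewrite -tens_compE ?compf1 ?comp1f. Qed.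
Arguments tensEr : clear implicits.

Lemma exchange f g n p m q : dom f = n -> cod g = p -> cod f = m -> dom g = q ->
  (f ⊗ idn p) ∘ (idn n ⊗ g) = (idn m ⊗ g) ∘ (f ⊗ idn q).
Proof. by move=> *; rewrite -tensEl // -tensEr. Qed.
Arguments exchange : clear implicits.

Lemma swapDl m n p : σ (m + n) p = (σ m p ⊗ idn n) ∘ (idn m ⊗ σ n p).
Proof.
by rewrite -dagger_swap swapDr dagger_comp // !dagger_tens !dagger_swap !dagger1.
Qed.

Lemma swap0l n : σ 0 n = idn n.
Proof. by rewrite -dagger_swap swap0r dagger1. Qed.

Lemma swapDD a b c d : σ (a + b) (c + d) =
  (idn c ⊗ σ a d ⊗ idn b) ∘ (σ a c ⊗ σ b d) ∘ (idn a ⊗ σ b c ⊗ idn d).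
Proof.
rewrite swapDr !swapDl tens1_comp // comp_tens1 //.
rewrite (tensEr (σ a c) (σ b d) (c + a) (b + d)) // -!tens1 !tensA.
by rewrite !compA.
Qed.

Lemma middleK a b c d :
  (idn a ⊗ σ b c ⊗ idn d) ∘ (idn a ⊗ σ c b ⊗ idn d) = idn (a + (c + b) + d).
Proof. by rewrite -!tens_compE // swapK !compf1 // !tens1. Qed.

(** The interchange [(x, x', y, y') ↦ (x, y, x', y')], which regroups two pairs of copies into two
    copies of the pair. *)
Definition mid m n := idn m ⊗ σ m n ⊗ idn n.

Lemma middle_natural f f' g g' :
  (idn (cod f) ⊗ σ (cod f') (cod g) ⊗ idn (cod g')) ∘ ((f ⊗ f') ⊗ (g ⊗ g')) =
  ((f ⊗ g) ⊗ (f' ⊗ g')) ∘ (idn (dom f) ⊗ σ (dom f') (dom g) ⊗ idn (dom g')).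
Proof.
rewrite !tensA -(tensA f f' g) -(tensA f g f') -!tens_compE //.
by rewrite swap_natural !compf1 // !comp1f.
Qed.

Local Notation μ c := (mk (mu c)).
Local Notation η c := (mk (eta c)).
Local Notation δ c := ((μ c)^†).
Local Notation ε c := ((η c)^†).
Local Notation μg := (μ Green).
Local Notation ηg := (η Green).
Local Notation δg := (δ Green).
Local Notation εg := (ε Green).
Local Notation μr := (μ Red).
Local Notation ηr := (η Red).
Local Notation δr := (δ Red).
Local Notation εr := (ε Red).

(** * Green comultiplication on several wires, and the Frobenius laws *)

Fixpoint comul m : mor :=
  if m is m'.+1 then mid 1 m' ∘ (δg ⊗ comul m') else idn 0.

Lemma dom_comul m : dom (comul m) = m.
Proof. by elim: m => //= m IHm; rewrite !typeE IHm. Qed.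

Lemma cod_comul m : cod (comul m) = m + m.
Proof. by case: m => //= m; rewrite /mid. Qed.

Lemma comul0 : comul 0 = idn 0. Proof. by []. Qed.
Lemma comulS m : comul m.+1 = mid 1 m ∘ (δg ⊗ comul m). Proof. by []. Qed.

Ltac typecheck ::= rewrite /mid ?(typeE, dom_comul, cod_comul); lia.
Arguments comul : simpl never.

Lemma comulD m p : comul (m + p) = mid m p ∘ (comul m ⊗ comul p).
Proof.
elim: m => [|m IHm]; first by rewrite add0n /mid swap0l comul0 !tens0f tens1 comp1f.
rewrite addSn !comulS IHm /mid.
rewrite -[in _ ⊗ (_ ∘ _)](@comp1f δg 2) // tens_compE //.
rewrite -[X in _ = _ ∘ (_ ⊗ X)](@comp1f (comul p) (p + p)) // tens_compE //.
rewrite !compA //; congr (_ ∘ _); last exact: tensA.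
(* Only an identity between block permutations remains. The hexagons split it into elementary
   crossings, and two of these act on disjoint wires and so commute. *)
rewrite -[1 + m]/(m.+1) -[in σ m.+1 p](add1n m) swapDl swapDr.
rewrite !(tens1_comp, comp_tens1) // -(tens1 m p) -(tens1 1 m) -(tens1 p p) -(tens1 1 1).
rewrite !tensA -!compA //; congr (_ ∘ _).
have := exchange (idn 1 ⊗ σ 1 m) (σ m p ⊗ idn p) (1 + 1 + m) (p + m + p)
  (1 + m + 1) (m + p + p).
by rewrite -!tens1 !tensA => ->.
Qed.

Lemma mid_dagger m n : (mid m n)^† ∘ mid m n = idn (m + m + (n + n)).
Proof.
by rewrite /mid !dagger_tens !dagger1 dagger_swap middleK; congr (idn _).
Qed.

Lemma mulA c : μ c ∘ (μ c ⊗ idn 1) = μ c ∘ (idn 1 ⊗ μ c).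
Proof. by rewrite !mkE; apply/mk_eq/mu_assoc. Qed.

Lemma mulC c : μ c ∘ σ 1 1 = μ c.
Proof. by rewrite mkE; apply/mk_eq/mu_comm. Qed.

Lemma mul1f c : μ c ∘ (η c ⊗ idn 1) = idn 1.
Proof. by rewrite !mkE; apply/mk_eq/mu_unit_l. Qed.

Lemma mulf1 c : μ c ∘ (idn 1 ⊗ η c) = idn 1.
Proof. by rewrite !mkE; apply/mk_eq/mu_unit_r. Qed.

Lemma frobl c : (μ c ⊗ idn 1) ∘ (idn 1 ⊗ δ c) = δ c ∘ μ c.
Proof. by rewrite !mkE; apply/mk_eq/frobenius_l. Qed.

Lemma frobr c : (idn 1 ⊗ μ c) ∘ (δ c ⊗ idn 1) = δ c ∘ μ c.
Proof. by rewrite !mkE; apply/mk_eq/eqIF_sym/frobenius_r. Qed.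

Lemma muK c : μ c ∘ δ c = idn 1.
Proof. by rewrite !mkE; apply/mk_eq/special. Qed.

Lemma deltaA c : (δ c ⊗ idn 1) ∘ δ c = (idn 1 ⊗ δ c) ∘ δ c.
Proof.
by have := congr1 dagger (mulA c); rewrite !dagger_comp // !dagger_tens !dagger1.
Qed.

Lemma deltaC c : σ 1 1 ∘ δ c = δ c.
Proof. by rewrite -{1}dagger_swap -dagger_comp // mulC. Qed.

Lemma delta1f c : (ε c ⊗ idn 1) ∘ δ c = idn 1.
Proof. by rewrite -{1}dagger1 -dagger_tens -dagger_comp // mul1f dagger1. Qed.

Lemma deltaf1 c : (idn 1 ⊗ ε c) ∘ δ c = idn 1.
Proof. by rewrite -{1}dagger1 -dagger_tens -dagger_comp // mulf1 dagger1. Qed.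

Lemma comul_special m : (comul m)^† ∘ comul m = idn m.
Proof.
elim: m => [|m IHm]; first by rewrite comul0 dagger1 compf1.
rewrite comulS dagger_comp // -compA // [_ ∘ (mid _ _ ∘ _)]compA // mid_dagger.
by rewrite comp1f // dagger_tens -tens_compE // daggerK IHm muK tens1.
Qed.

Lemma swap_mid m n : σ (m + n) (m + n) ∘ mid m n = mid m n ∘ (σ m m ⊗ σ n n).
Proof.
rewrite swapDD -/(mid m n) -[LHS]compA //.
by rewrite /mid middleK compf1.
Qed.

Lemma comul_cocomm m : σ m m ∘ comul m = comul m.
Proof.
elim: m => [|m IHm]; first by rewrite comul0 swap0l compf1.
by rewrite comulS compA // (swap_mid 1 m) -compA // -tens_compE // deltaC IHm.
Qed.

(** * Copyable and reciprocal morphisms *)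

Definition copyable f := comul (cod f) ∘ f = (f ⊗ f) ∘ comul (dom f).

(** Frobenius reciprocity. When [f] is a function seen as a relation, both sides relate [y] to the
    pairs [(y, x)] with [f x = y]. *)
Definition reciprocal f :=
  (f ⊗ idn (dom f)) ∘ comul (dom f) ∘ f^† = (idn (cod f) ⊗ f^†) ∘ comul (cod f).

Lemma copyable_id n : copyable (idn n).
Proof. by rewrite /copyable !typeE tens1 compf1 // comp1f. Qed.

Lemma copyable_comp f g : cod g = dom f -> copyable f -> copyable g -> copyable (f ∘ g).
Proof.
rewrite /copyable => gf Hf Hg.
by rewrite !typeE compA // Hf -compA // -gf Hg tens_compE // compA.
Qed.

Lemma copyable_tens f g : copyable f -> copyable g -> copyable (f ⊗ g).
Proof.
rewrite /copyable => Hf Hg; rewrite !typeE !comulD.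
rewrite -[LHS]compA // -tens_compE // Hf Hg tens_compE // !compA //.
by congr (_ ∘ _); apply: middle_natural.
Qed.

Lemma copyable_swap m n : copyable (σ m n).
Proof.
rewrite /copyable !typeE !comulD -compA //.
have -> : (comul n ⊗ comul m) ∘ σ m n = σ (m + m) (n + n) ∘ (comul m ⊗ comul n).
  by have := swap_natural (comul m) (comul n); rewrite !dom_comul !cod_comul.
rewrite swapDD !compA //; congr (_ ∘ _).
by rewrite /mid middleK comp1f.
Qed.

Lemma copyable_inv f g : cod g = dom f -> cod f = dom g ->
  f ∘ g = idn (dom g) -> g ∘ f = idn (dom f) -> copyable f -> copyable g.
Proof.
rewrite /copyable => gf fg fgK gfK Hf.
transitivity ((g ⊗ g) ∘ ((f ⊗ f) ∘ comul (dom f)) ∘ g).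
  by rewrite compA // -tens_compE // gfK tens1 comp1f // gf.
by rewrite -Hf -!compA // fgK compf1 // fg.
Qed.

(** The law for [g] moves [g^†] to the second copy; there it slides past [f], and the law for [f]
    applies. *)
Lemma reciprocal_comp f g : cod g = dom f ->
  reciprocal f -> reciprocal g -> reciprocal (f ∘ g).
Proof.
rewrite /reciprocal => gf Kf Kg; rewrite !typeE dagger_comp // comp_tens1 //.
transitivity ((f ⊗ idn (dom g)) ∘ ((g ⊗ idn (dom g)) ∘ comul (dom g) ∘ g^†) ∘ f^†).
  by rewrite !compA.
rewrite Kg compA // gf (exchange f g^† _ _ (cod f) (cod g)) //.
rewrite tens1_comp // -!compA //; congr (_ ∘ _).
by rewrite compA // gf Kf.
Qed.

Lemma reciprocal_tens f g : reciprocal f -> reciprocal g -> reciprocal (f ⊗ g).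
Proof.
rewrite /reciprocal => Kf Kg; rewrite !typeE !comulD -!tens1 dagger_tens.
have nf := middle_natural f (idn (dom f)) g (idn (dom g)).
have ng := middle_natural (idn (cod f)) f^† (idn (cod g)) g^†.
move: nf ng; rewrite !typeE -!/(mid _ _) => nf ng.
rewrite !compA // -nf -ng -!compA //; congr (_ ∘ _).
by rewrite -!tens_compE // !compA // Kf Kg.
Qed.

(** As the inverse of [f], [f^†] is copyable too, and [f] cancels the first of its two copies. *)
Lemma reciprocal_unitary f : copyable f ->
  f ∘ f^† = idn (cod f) -> f^† ∘ f = idn (dom f) -> reciprocal f.
Proof.
move=> Hf fK fK'; have Hf' : copyable f^† by apply: copyable_inv Hf; rewrite ?typeE.
rewrite /reciprocal -compA //; move: Hf'; rewrite /copyable !typeE => ->.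
by rewrite compA // -tens_compE // fK comp1f.
Qed.

Lemma reciprocal_inv f g : cod g = dom f -> cod f = dom g ->
  f ∘ g = idn (dom g) -> g ∘ f = idn (dom f) ->
  copyable f -> reciprocal f -> g = f^†.
Proof.
move=> gf fg fgK gfK Hf Kf; set h := f^† ∘ f; set D := comul (dom f).
have cancel_f x y : cod x = dom f -> cod y = dom f -> f ∘ x = f ∘ y -> x = y.
  by move=> xf yf /(congr1 (comp g)); rewrite !compA // gfK !comp1f.
have Dh : (idn (dom f) ⊗ h) ∘ D = D ∘ h.
  transitivity ((g ⊗ idn (dom f)) ∘ ((f ⊗ h) ∘ D)).
    by rewrite compA // -tens_compE // gfK comp1f.
  (* By reciprocity the right side is [(1 ⊗ f†) Δ f], and copying [f] gives [(f ⊗ f† f) Δ]. *)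
  have -> : (f ⊗ h) ∘ D = (f ⊗ idn (dom f)) ∘ D ∘ f^† ∘ f.
    rewrite Kf -compA // Hf compA // -tens_compE // comp1f //.
  by rewrite !compA // -tens_compE // gfK compf1 // tens1 comp1f // -compA.
have hD : (h ⊗ idn (dom f)) ∘ D = D ∘ h.
  rewrite -{1}[D](comul_cocomm (dom f)) compA //.
  have := swap_natural (idn (dom f)) h; rewrite !typeE => <-.
  by rewrite -compA // Dh compA // comul_cocomm.
have h1 : h = idn (dom f).
  have -> : h = D^† ∘ ((h ⊗ idn (dom f)) ∘ D).
    by rewrite hD compA // comul_special comp1f.
  apply: cancel_f => //; rewrite compf1 //.
  (* The dagger of reciprocity reads [f M (f† ⊗ 1) = M (1 ⊗ f)]. Hence
     [f M (h ⊗ 1) Δ = M (f ⊗ f) Δ = M Δ f = f]. *)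
  have := congr1 dagger Kf; rewrite !(dagger_comp, dagger_tens, dagger1, daggerK) // => Kf'.
  rewrite /h comp_tens1 // !compA // -[f ∘ D^† ∘ _]compA // Kf'.
  rewrite -[_ ∘ _ ∘ (f ⊗ _)]compA // -tens_compE // comp1f // compf1 //.
  by rewrite -compA // -Hf compA // comul_special comp1f.
by rewrite -[RHS](@compf1 _ (dom g)) // -fgK compA // -/h h1 comp1f.
Qed.

(** * Cups, caps and mixed snakes *)

Definition cup c := δ c ∘ η c.
Definition cap c := ε c ∘ μ c.
(** A snake with possibly different colours: the identity if they agree, the antipode for [Green]
    and [Red]. *)
Definition transp a b := (cap a ⊗ idn 1) ∘ (idn 1 ⊗ cup b).
Definition conv f g := μr ∘ (f ⊗ g) ∘ δg.
(* The dagger of [antipode]; [antipodeE] shows that the two are equal. *)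
Definition antip := transp Red Green.
(** The map [(x, b) ↦ (x + f b, b)]. *)
Definition shear f := (μr ⊗ idn 1) ∘ (idn 1 ⊗ ((f ⊗ idn 1) ∘ δg)).

Ltac typecheck ::=
  rewrite /shear /conv /antip /transp /cap /cup /mid ?(typeE, dom_comul, cod_comul); lia.

Lemma capC c : cap c ∘ σ 1 1 = cap c.
Proof. by rewrite /cap -compA // mulC. Qed.

Lemma cupC c : σ 1 1 ∘ cup c = cup c.
Proof. by rewrite /cup compA // deltaC. Qed.

Lemma dagger_cup c : (cup c)^† = cap c.
Proof. by rewrite /cup dagger_comp // daggerK. Qed.

Lemma dagger_cap c : (cap c)^† = cup c.
Proof. by rewrite -dagger_cup daggerK. Qed.

Lemma cap_delta c : (cap c ⊗ idn 1) ∘ (idn 1 ⊗ δ c) = μ c.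
Proof.
by rewrite /cap comp_tens1 // -compA // frobl compA // delta1f comp1f.
Qed.

Lemma mul_cup c : (μ c ⊗ idn 1) ∘ (idn 1 ⊗ cup c) = δ c.
Proof. by rewrite /cup tens1_comp // compA // frobl -compA // mulf1 compf1. Qed.

Lemma cup_mul c : (idn 1 ⊗ μ c) ∘ (cup c ⊗ idn 1) = δ c.
Proof. by rewrite /cup comp_tens1 // compA // frobr -compA // mul1f compf1. Qed.

Lemma snakel c : (cap c ⊗ idn 1) ∘ (idn 1 ⊗ cup c) = idn 1.
Proof. by rewrite /cup tens1_comp // compA // cap_delta mulf1. Qed.

Lemma snaker c : (idn 1 ⊗ cap c) ∘ (cup c ⊗ idn 1) = idn 1.
Proof. by rewrite /cap tens1_comp // -compA // cup_mul deltaf1. Qed.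

Lemma swap_slide n x : dom x = n -> cod x = 2 ->
  (σ 1 1 ⊗ idn 1) ∘ (idn 1 ⊗ x) = (idn 1 ⊗ σ 1 1) ∘ ((x ⊗ idn 1) ∘ σ 1 n).
Proof.
move=> <- x2; have := swap_natural (idn 1) x.
rewrite !typeE x2 -[2]/(1 + 1) swapDr => <-.
by rewrite -compA // compA // -tens1_comp // swapK tens1 comp1f.
Qed.

(** Caps and cups are symmetric, so a snake equals its mirror image. This makes the dagger of a
    snake a snake again. *)
Lemma transp_sym a b : (idn 1 ⊗ cap a) ∘ (cup b ⊗ idn 1) = transp a b.
Proof.
have -> : cup b ⊗ idn 1 = (idn 1 ⊗ σ 1 1) ∘ ((σ 1 1 ⊗ idn 1) ∘ (idn 1 ⊗ cup b)).
  rewrite (@swap_slide 0) // swap0r compf1 // compA // -tens1_comp // swapK tens1.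
  by rewrite comp1f.
rewrite compA // -tens1_comp // capC -{1}(cupC b) tens1_comp //.
rewrite [(σ 1 1 ⊗ _) ∘ _]compA // -swapDl compA //.
by have := swap_natural (cap a) (idn 1); rewrite !typeE swap0l comp1f // => <-.
Qed.

Lemma dagger_transp a b : (transp a b)^† = transp b a.
Proof.
by rewrite dagger_comp // !dagger_tens dagger1 dagger_cup dagger_cap transp_sym.
Qed.

Lemma cap_transp a b : cap a ∘ (transp b a ⊗ idn 1) = cap b.
Proof.
rewrite comp_tens1 // -!tensA tens1 compA //.
have := exchange (cap b) (cap a) 2 0 0 2; rewrite tens0f tensf0 => <- //.
rewrite -[idn (1 + 1)](tens1 1 1) -tensA -compA // -tens1_comp // snaker tens1.
by rewrite compf1.
Qed.

Lemma transp_cup a b : (transp a b ⊗ idn 1) ∘ cup a = cup b.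
Proof.
rewrite -(dagger_cap b) -(cap_transp a b) dagger_comp // dagger_tens dagger1.
by rewrite dagger_transp dagger_cap.
Qed.

Lemma transpK a b : transp a b ∘ transp b a = idn 1.
Proof.
have := exchange (transp b a) (cup b) 1 2 1 0; rewrite tensf0 => e.
rewrite {1}/transp -compA // -e // -[idn 2](tens1 1 1) tensA compA //.
by rewrite -comp_tens1 // cap_transp snakel.
Qed.

(** Write [μ] as [δ] with one leg bent by a cap: copying [x] then disconnects the input from the
    output. *)
Lemma mul_copyable_point c x : dom x = 0 -> cod x = 1 -> δ c ∘ x = x ⊗ x ->
  μ c ∘ (idn 1 ⊗ x) = x ∘ (cap c ∘ (idn 1 ⊗ x)).
Proof.
move=> x0 x1 Hx; rewrite -cap_delta -compA // -tens1_comp // Hx tensA.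
by rewrite -tens_compE // comp1f // (tensEr _ _ 0 0) // tens0f tensf0.
Qed.

(** * Interaction of the two colours *)

Lemma etaR_def : ηr = (εr ⊗ idn 1) ∘ cup Green.
Proof. by rewrite /cup compA // !mkE; apply/mk_eq/eta_Red_eq. Qed.

Lemma epsG_def : εg = cap Red ∘ (idn 1 ⊗ ηg).
Proof. by rewrite /cap !mkE; apply/mk_eq/epsilon_Green_eq. Qed.

Lemma etaR_copy : δg ∘ ηr = ηr ⊗ ηr.
Proof. by rewrite !mkE; apply/mk_eq/bialgebra_unit. Qed.

Lemma etaG_copy : δr ∘ ηg = ηg ⊗ ηg.
Proof.
suff /(congr1 dagger) : εg ∘ μr = εg ⊗ εg by rewrite dagger_comp // !dagger_tens daggerK.
by rewrite !mkE; apply/mk_eq/bialgebra_counit.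
Qed.

Lemma bialgebra_mid : δg ∘ μr = (μr ⊗ μr) ∘ mid 1 1 ∘ (δg ⊗ δg).
Proof. by rewrite /mid !mkE; apply/mk_eq/bialgebra. Qed.

Lemma mulR_etaG : μr ∘ (idn 1 ⊗ ηg) = ηg ∘ εg.
Proof. by rewrite mul_copyable_point ?etaG_copy // epsG_def. Qed.

Lemma mulG_etaR : μg ∘ (idn 1 ⊗ ηr) = ηr ∘ εr.
Proof.
rewrite mul_copyable_point ?etaR_copy //; congr (_ ∘ _).
rewrite [in RHS]etaR_def dagger_comp // dagger_tens daggerK dagger1 dagger_cup.
rewrite -[in LHS]capC -compA //.
by have := swap_natural (idn 1) ηr; rewrite !typeE swap0r compf1 // => ->.
Qed.

Lemma cap_mid_cup a b : (cap a ⊗ idn 2) ∘ mid 1 1 ∘ (idn 2 ⊗ cup b) =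
  σ 1 1 ∘ (transp a b ⊗ idn 1).
Proof.
rewrite -compA // /mid -[idn 2](tens1 1 1) -!tensA -tens1_comp //.
rewrite (@swap_slide 0) // swap0r compf1 // /transp.
rewrite tens1_comp // comp_tens1 // -!tensA !compA //; congr (_ ∘ _).
rewrite tens1 tensA tens1 (exchange (cap a) (σ 1 1) _ _ 0 2) //.
by rewrite tens0f.
Qed.

Lemma antip_convl : conv antip (idn 1) = ηr ∘ εg.
Proof.
(* This is the left side of the bialgebra law with [εr] on the first output and [ηg] on the second
   input. On the right side they create a red cap and a green cup, whose snake is [antip]. *)
have <- : (εr ⊗ idn 1) ∘ (δg ∘ μr) ∘ (idn 1 ⊗ ηg) = ηr ∘ εg.
  by rewrite -!compA // mulR_etaG [in RHS]etaR_def /cup !compA.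
rewrite bialgebra_mid.
have -> : (εr ⊗ idn 1) ∘ ((μr ⊗ μr) ∘ mid 1 1 ∘ (δg ⊗ δg)) ∘ (idn 1 ⊗ ηg) =
    ((εr ⊗ idn 1) ∘ (μr ⊗ μr)) ∘ mid 1 1 ∘ ((δg ⊗ δg) ∘ (idn 1 ⊗ ηg)).
  by rewrite !compA.
rewrite -[X in _ = X ∘ _ ∘ _]tens_compE // -[X in _ = _ ∘ X]tens_compE //.
rewrite comp1f // compf1 // -/(cap Red) -/(cup Green).
rewrite (tensEr _ μr 0 2) // (tensEr δg _ 2 0) // tens0f tensf0.
transitivity (μr ∘ ((cap Red ⊗ idn 2) ∘ mid 1 1 ∘ (idn 2 ⊗ cup Green)) ∘ δg).
  by rewrite cap_mid_cup -/antip !compA // mulC.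
by rewrite !compA.
Qed.

(** * Convolution and shears *)

Lemma conv_comm f g : dom f = 1 -> cod f = 1 -> dom g = 1 -> cod g = 1 ->
  conv f g = conv g f.
Proof.
move=> f1 f1' g1 g1'; rewrite /conv -{1}(mulC Red).
have := swap_natural f g; rewrite f1 f1' g1 g1' => e.
by rewrite -[_ ∘ _ ∘ (f ⊗ g)]compA // e compA // -[LHS]compA // deltaC.
Qed.

(** Both sides send [(x, b)] to [(x + g b + f b, b)], by associativity of [μr] and coassociativity
    of [δg]. *)
Lemma shear_comp f g : dom f = 1 -> cod f = 1 -> dom g = 1 -> cod g = 1 ->
  shear f ∘ shear g = shear (conv g f).
Proof.
move=> f1 f1' g1 g1'; rewrite /shear.
have -> : (μr ⊗ idn 1) ∘ (idn 1 ⊗ ((f ⊗ idn 1) ∘ δg)) ∘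
    ((μr ⊗ idn 1) ∘ (idn 1 ⊗ ((g ⊗ idn 1) ∘ δg))) =
  (μr ⊗ idn 1) ∘ ((idn 1 ⊗ ((f ⊗ idn 1) ∘ δg)) ∘ (μr ⊗ idn 1)) ∘
    (idn 1 ⊗ ((g ⊗ idn 1) ∘ δg)) by rewrite !compA.
rewrite -(exchange μr ((f ⊗ idn 1) ∘ δg) 2 2) //.
rewrite -[idn 2](tens1 1 1) (tensA μr) -[(idn 1 ⊗ idn 1) ⊗ _]tensA.
rewrite !compA // -comp_tens1 // mulA comp_tens1 // -!compA //; congr (_ ∘ _).
rewrite -tensA -!tens1_comp //; congr (_ ⊗ _).
rewrite /conv !comp_tens1 // -!compA //; congr (_ ∘ _).
rewrite deltaA !compA //; congr (_ ∘ _).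
by rewrite -tensA -!tens_compE // comp1f // !compf1.
Qed.

Lemma shear_unit : shear (ηr ∘ εg) = idn 2.
Proof.
rewrite /shear comp_tens1 // -compA // delta1f compf1 // tensA -comp_tens1 //.
by rewrite mulf1 tens1.
Qed.

(** Start the shear at [x = 0] and discard [b]. Thus [shear] is injective, and properties of a shear
    pass to [f]. *)
Lemma shear_conv f : dom f = 1 -> cod f = 1 ->
  (idn 1 ⊗ εg) ∘ shear f ∘ (ηr ⊗ idn 1) = f.
Proof.
move=> f1 f1'; rewrite /shear.
have -> : (idn 1 ⊗ εg) ∘ ((μr ⊗ idn 1) ∘ (idn 1 ⊗ ((f ⊗ idn 1) ∘ δg))) ∘
    (ηr ⊗ idn 1) =
  ((idn 1 ⊗ εg) ∘ (μr ⊗ idn 1)) ∘ ((idn 1 ⊗ ((f ⊗ idn 1) ∘ δg)) ∘ (ηr ⊗ idn 1)).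
  by rewrite !compA.
rewrite -(exchange μr εg 2 0) // -(exchange ηr _ 0 2) //.
rewrite tensf0 tens0f -[in idn 2 ⊗ _](tens1 1 1) -tensA.
transitivity (μr ∘ ((idn 1 ⊗ (idn 1 ⊗ εg)) ∘ (ηr ⊗ idn 2)) ∘ ((f ⊗ idn 1) ∘ δg)).
  by rewrite !compA.
rewrite -(exchange ηr _ 0 1) // tens0f !compA // mul1f comp1f //.
by rewrite -(exchange f εg 1 0) // tensf0 -compA // deltaf1 compf1.
Qed.

Lemma antip_counit : εg ∘ antip = εg.
Proof.
rewrite /antip /transp compA //; have := exchange (cap Red) εg 2 0 0 1.
rewrite tens0f tensf0 => <- //; rewrite -[idn 2](tens1 1 1) -tensA -compA //.
by rewrite -tens1_comp // /cup compA // deltaf1 comp1f // epsG_def.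
Qed.

Lemma shear_antipK : shear antip ∘ shear (idn 1) = idn 2.
Proof.
by rewrite shear_comp // conv_comm // antip_convl shear_unit.
Qed.

Lemma shear1K : shear (idn 1) ∘ shear antip = idn 2.
Proof. by rewrite shear_comp // antip_convl shear_unit. Qed.

(** * Copyability of the generators *)

Lemma comul1 : comul 1 = δg.
Proof. by rewrite comulS comul0 tensf0 /mid swap0r !tensf0 tens1 comp1f. Qed.

Lemma comul2 : comul 2 = mid 1 1 ∘ (δg ⊗ δg).
Proof. by rewrite comulS comul1. Qed.

Lemma copyable_delta : copyable δg.
Proof.
have e : (δg ⊗ δg) ∘ δg = (idn 1 ⊗ δg ⊗ idn 1) ∘ ((δg ⊗ idn 1) ∘ δg).
  rewrite (tensEl δg δg 1 2) // -compA // -deltaA -[idn 2](tens1 1 1) tensA.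
  by rewrite !compA // -!comp_tens1 // deltaA.
rewrite /copyable !typeE comul1 comul2 -compA // e compA // /mid.
by rewrite -comp_tens1 // -tens1_comp // deltaC.
Qed.

Lemma copyable_eps : copyable εg.
Proof.
rewrite /copyable !typeE comul1 comul0 comp1f // (tensEl _ _ 1 0) // tensf0 -compA //.
by rewrite deltaf1 compf1.
Qed.

Lemma copyable_mu : copyable μr.
Proof. by rewrite /copyable !typeE comul1 comul2 bialgebra_mid compA. Qed.

Lemma copyable_eta : copyable ηr.
Proof. by rewrite /copyable !typeE comul1 comul0 etaR_copy compf1. Qed.

Lemma copyable_shear1 : copyable (shear (idn 1)).
Proof.
apply: copyable_comp => //.
  by apply: copyable_tens; [apply: copyable_mu|apply: copyable_id].
apply: copyable_tens; first exact: copyable_id.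
by rewrite tens1 comp1f //; apply: copyable_delta.
Qed.

Lemma copyable_antip : copyable antip.
Proof.
rewrite -(@shear_conv antip) //; do 2?[apply: copyable_comp => //].
- by apply: copyable_tens; [apply: copyable_id|apply: copyable_eps].
- by apply: copyable_inv copyable_shear1; rewrite ?typeE ?shear1K ?shear_antipK.
- by apply: copyable_tens; [apply: copyable_eta|apply: copyable_id].
Qed.

(** * The antipode as a self-adjoint involution *)

(** Since [antip] is copyable, precomposing [antip_convl] with it makes [antip ∘ antip] a
    convolution inverse of [antip], as the identity already is. Uniqueness of inverses is read off
    from the shears. *)
Lemma antipK : antip ∘ antip = idn 1.
Proof.
have antip_conv : conv (antip ∘ antip) antip = ηr ∘ εg.
  transitivity (conv antip (idn 1) ∘ antip).
    have := copyable_antip; rewrite /copyable !typeE comul1 => e.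
    have te : (antip ∘ antip) ⊗ antip = (antip ⊗ idn 1) ∘ (antip ⊗ antip).
      by rewrite -tens_compE // comp1f.
    by rewrite /conv te -[RHS]compA // e !compA.
  by rewrite antip_convl -compA // antip_counit.
have e : shear (antip ∘ antip) = shear (idn 1).
  rewrite -[LHS](@comp1f _ 2) // -shear1K -compA //.
  by rewrite shear_comp // antip_conv shear_unit compf1.
by rewrite -[LHS]shear_conv // e shear_conv.
Qed.

Lemma mk_antipode : mk antipode = transp Green Red.
Proof. by rewrite /transp /cap /cup !mkE. Qed.

(** Both are inverse to [antip], by [transpK] and by [antipK]. *)
Lemma antipodeE : mk antipode = antip.
Proof.
rewrite mk_antipode -[LHS](@comp1f _ 1) // -antipK -compA // /antip.
by rewrite transpK compf1.
Qed.

Lemma dagger_antip : antip^† = antip.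
Proof. by rewrite {1}/antip dagger_transp -mk_antipode antipodeE. Qed.

(** The dagger is [(1 ⊗ μg) (δr ⊗ 1)]. Here [δr] is [μr] with a red cup on one input, the red cup is
    a green cup followed by [antip], and the green cup bends [μg] into [δg]. *)
Lemma dagger_shear1 : (shear (idn 1))^† = shear antip.
Proof.
have cupE : cup Red = (antip ⊗ idn 1) ∘ cup Green.
  by rewrite -antipodeE mk_antipode transp_cup.
rewrite /shear tens1 comp1f // dagger_comp // !dagger_tens !dagger1 !daggerK.
rewrite -(mul_cup Red) cupE comp_tens1 // compA // -!tensA tens1.
rewrite -(exchange μr μg 2 1 1 2) // -compA // -[idn 2](tens1 1 1) -tensA.
rewrite -tens1_comp // comp_tens1 // compA // -tensA tens1.
by rewrite -(exchange antip μg 1 1) // -compA // cup_mul.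
Qed.

(** * Reciprocity of the generators *)

Lemma reciprocal_eps : reciprocal εg.
Proof.
by rewrite /reciprocal !typeE comul1 comul0 daggerK delta1f tens0f !compf1 // comp1f.
Qed.

Lemma reciprocal_id n : reciprocal (idn n).
Proof. by rewrite /reciprocal !typeE dagger1 tens1 compf1. Qed.

Lemma reciprocal_mu : reciprocal μr.
Proof.
have -> : μr = (idn 1 ⊗ εg) ∘ shear (idn 1).
  rewrite /shear compA // tens1 comp1f // -(exchange μr εg 2 0) // tensf0.
  by rewrite -[idn 2](tens1 1 1) -tensA -compA // -tens1_comp // deltaf1 tens1 compf1.
apply: reciprocal_comp => //.
  by apply: reciprocal_tens; [apply: reciprocal_id|apply: reciprocal_eps].
apply: (reciprocal_unitary copyable_shear1);
  by rewrite dagger_shear1 ?shear1K ?shear_antipK /shear !typeE.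
Qed.

Lemma reciprocal_antip : reciprocal antip.
Proof.
apply: (reciprocal_unitary copyable_antip);
  by rewrite dagger_antip antipK /antip /transp !typeE.
Qed.

Lemma reciprocal_swap m n : reciprocal (σ m n).
Proof.
apply: (reciprocal_unitary (@copyable_swap m n));
  by rewrite dagger_swap swapK !typeE.
Qed.

(** For [ηr] the law is the dagger of [mulG_etaR]. *)
Lemma reciprocal_eta : reciprocal ηr.
Proof.
rewrite /reciprocal !typeE comul1 comul0 tensf0 compf1 //.
have := congr1 dagger mulG_etaR.
by rewrite !dagger_comp // dagger_tens dagger1 daggerK => ->.
Qed.

Lemma reciprocal_delta : reciprocal δg.
Proof.
(* The Frobenius law in the crossed form produced by [mid]; commutativity absorbs the crossing. *)
have e : (idn 1 ⊗ μg) ∘ (σ 1 1 ⊗ idn 1) ∘ (idn 1 ⊗ δg) = δg ∘ μg.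
  rewrite -compA // (@swap_slide 1) // compA // -tens1_comp // mulC.
  by rewrite compA // frobr -compA // mulC.
rewrite /reciprocal !typeE comul1 comul2 daggerK deltaA (tensEr δg δg 2 1) //.
rewrite /mid -[idn 2](tens1 1 1) -!tensA !compA // -!tens1_comp // e.
by rewrite tens1_comp // -[RHS]compA // frobr compA.
Qed.

(** * Both laws on all of [HA], and unitarity *)

Lemma HA_copyable_reciprocal m n (f : term m n) :
  HA f -> copyable (mk f) /\ reciprocal (mk f).
Proof.
elim=> {m n f} [n|m n|m n p f g _ [cf rf] _ [cg rg]|m n p q f g _ [cf rf] _ [cg rg]
  |||||| m n f g fg _ [cf rf]].
- by split; [apply: copyable_id|apply: reciprocal_id].
- by split; [apply: copyable_swap|apply: reciprocal_swap].
- by rewrite -mk_comp; split; [apply: copyable_comp|apply: reciprocal_comp].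
- by rewrite -mk_tens; split; [apply: copyable_tens|apply: reciprocal_tens].
- by rewrite -mk_dag; split; [apply: copyable_delta|apply: reciprocal_delta].
- by rewrite -mk_dag; split; [apply: copyable_eps|apply: reciprocal_eps].
- by split; [apply: copyable_mu|apply: reciprocal_mu].
- by split; [apply: copyable_eta|apply: reciprocal_eta].
- by rewrite antipodeE; split; [apply: copyable_antip|apply: reciprocal_antip].
- by rewrite -(mk_eq fg).
Qed.

Local Close Scope mor_scope.

Theorem theorem6 (m n : nat) (f : term m n) (finv : term n m)
  (f_invertible : is_inverse f finv) (f_in_HA : HA f) :
  finv ≈ f^†.
Proof.
case: f_invertible => gfK fgK; have [cf rf] := HA_copyable_reciprocal f_in_HA.
apply: mk_inj; rewrite -mk_dag; apply: reciprocal_inv => //.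
  by rewrite mk_comp; apply: mk_eq.
by rewrite mk_comp; apply: mk_eq.
Qed.
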